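(* Fix $a>0$, a positive integer $E$, positive source weights $w_1,\dots,w_E$ summing to one, and a tolerance $\eta>0$. There exist $E$ training environments, with mismatch probabilities $\delta_1,\dots,\delta_E$, and a target environment, with mismatch probability $\delta_{\mathrm{te}}$, all from the environment model $P_\delta$ and all having the same input support (i.e. the set of $\mathbf{x}\in\{0,1\}^2$ with positive probability under the law of $\mathbf{X}$ is the same in all of them), such that $$0\le \max_{f\in\mathcal{F}}J_{\mathrm{tr}}(f)-J_{\mathrm{tr}}(f_S)\le\eta,\qquad \mathcal{L}_{\mathrm{te}}(g_0\circ f_S)\ge 1-\eta,$$ while $g_0$ is source-optimal on $f_S$ and $\mathcal{L}_{\mathrm{te}}(g_0\circ f_C)=0$. The source mismatch probabilities $\delta_1,\dots,\delta_E$ can be chosen distinct. More explicitly, whenever $0<\delta_e\le\delta_{\max}<1/2$ for all $e=1,\dots,E$, one has $$J_\star(a)-J_{\mathrm{tr}}(f_S)=\sum_{e=1}^E w_e\,\Gamma_a(\delta_e)\le\frac{a^2}{2(1+a)}\,\delta_{\max},$$ and choosing $\delta_{\mathrm{te}}=1-\delta_{\max}$ yields target error $\mathcal{L}_{\mathrm{te}}(g_0\circ f_S)=1-\delta_{\max}$.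
   Context: Environment model. For $\delta\in[0,1]$, $P_\delta$ is the law of $(\mathbf{X},Y)$ with $Y\sim\mathrm{Bernoulli}(1/2)$, $\mathbf{X}=(C,S)\in\{0,1\}^2$, $C=Y$, $S=Y\oplus B$ (exclusive-or), $B\sim\mathrm{Bernoulli}(\delta)$ independent of $Y$. The number $\delta$ is the mismatch probability. Environment $e$ has law $P_e=P_{\delta_e}$; the target environment has law $P_{\mathrm{te}}=P_{\delta_{\mathrm{te}}}$. Encoders and classifier. $\mathcal{F}$ is the set of all functions $f:\{0,1\}^2\to\mathbb{S}^1\subset\mathbb{R}^2$ ($\mathbb{S}^1$ is the unit circle). With $\mathbf{b}_0=(1,0)^\top$, $\mathbf{b}_1=(0,1)^\top$, set $f_C(c,s)=\mathbf{b}_c$, $f_S(c,s)=\mathbf{b}_s$, and $g_0(\mathbf{z})=\mathbf{1}\{z_2>z_1\}$. Coding objective. For $f\in\mathcal{F}$ and environment $e$, let $\mathbf{M}_{e,y}(f)=\mathbb{E}_e[f(\mathbf{X})f(\mathbf{X})^\top\mid Y=y]$ and $\mathbf{M}_e(f)=\tfrac12(\mathbf{M}_{e,0}(f)+\mathbf{M}_{e,1}(f))$. For $a>0$, $$J_e(f)=\tfrac12\log\det(\mathbf{I}_2+a\mathbf{M}_e(f))-\tfrac14\sum_{y\in\{0,1\}}\log\det(\mathbf{I}_2+a\mathbf{M}_{e,y}(f)),\qquad J_{\mathrm{tr}}(f)=\sum_{e=1}^E w_eJ_e(f).$$ Also $J_\star(a)=\log(1+a/2)-\tfrac12\log(1+a)$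 and $\Gamma_a(\delta)=\tfrac12\log\big(1+\tfrac{a^2}{1+a}\delta(1-\delta)\big)$. Risk. For a classifier $g:\mathbb{S}^1\to\{0,1\}$, $\mathcal{L}_e(g\circ f)=P_e(g(f(\mathbf{X}))\ne Y)$, and $\mathcal{L}_{\mathrm{te}}$ is the same with $P_{\mathrm{te}}$. A classifier $g$ is source-optimal on $f$ if it minimises $\sum_{e=1}^E w_e\mathcal{L}_e(g\circ f)$ over all classifiers. *)

(* Defs.v *)
From mathcomp Require Import all_boot all_order all_algebra.
From mathcomp Require Import reals exp.

Set Implicit Arguments.
Unset Strict Implicit.
Unset Printing Implicit Defensive.

Import Order.TTheory GRing.Theory Num.Theory.

Local Open Scope ring_scope.

(* Bits are booleans: true = 1, false = 0; (+) is exclusive-or. *)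

Definition input : finType := (bool * bool)%type.

Definition bernoulli_pmf (R : realType) (p : R) (b : bool) : R :=
  if b then p else 1 - p.

(* The sample space consists of the pairs (y, b) of values of the two
   independent variables Y ~ Bernoulli(1/2) and B ~ Bernoulli(delta). *)
Definition base_pmf (R : realType) (delta : R) (o : bool * bool) : R :=
  bernoulli_pmf (2%:R^-1) o.1 * bernoulli_pmf delta o.2.

Definition Yvar (o : bool * bool) : bool := o.1.
Definition Xvar (o : bool * bool) : input := (Yvar o, Yvar o (+) o.2).

(* The probability mass function of (X, Y); it is a probability for
   0 <= delta <= 1 and meaningless otherwise. *)
Definition law (R : realType) (delta : R) (xy : input * bool) : R :=
  \sum_(o : bool * bool | (Xvar o, Yvar o) == xy) base_pmf delta o.

Definition Pr (R : realType) (delta : R) (A : pred (input * bool)) : R :=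
  \sum_(xy | A xy) law delta xy.

Definition input_support (R : realType) (delta : R) : {set input} :=
  [set x | 0 < Pr delta [pred xy | xy.1 == x]].

Record circle (R : realType) : Type := Circle {
  cvec :> 'cV[R]_2;
  cvecP : \sum_i cvec i ord0 ^+ 2 = 1 }.

Definition encoder (R : realType) : Type := input -> circle R.
Definition classifier (R : realType) : Type := circle R -> bool.

Definition basis_vec (R : realType) (c : bool) : 'cV[R]_2 :=
  delta_mx (if c then 1 else 0) 0.

Lemma basis_vecP (R : realType) (c : bool) :
  \sum_i basis_vec R c i ord0 ^+ 2 = 1.
Proof.
by rewrite big_ord_recl big_ord1 !mxE; case: c;
   rewrite /= ?expr1n ?expr0n /= ?addr0 ?add0r.
Qed.

Definition basis (R : realType) (c : bool) : circle R :=
  Circle (basis_vecP R c).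

Definition f_C (R : realType) : encoder R := fun x => basis R x.1.
Definition f_S (R : realType) : encoder R := fun x => basis R x.2.

Definition g_0 (R : realType) : classifier R :=
  fun z => z ord0 ord0 < z (lift ord0 ord0) ord0.

Definition cond_moment (R : realType) (delta : R) (y : bool) (f : encoder R) :
    'M[R]_2 :=
  (Pr delta [pred xy | xy.2 == y])^-1 *:
    \sum_(xy : input * bool | xy.2 == y)
      law delta xy *: ((f xy.1 : 'cV[R]_2) *m (f xy.1 : 'cV[R]_2)^T).

Definition avg_moment (R : realType) (delta : R) (f : encoder R) : 'M[R]_2 :=
  2%:R^-1 *: (cond_moment delta false f + cond_moment delta true f).

Definition J (R : realType) (a delta : R) (f : encoder R) : R :=
  2%:R^-1 * ln (\det (1%:M + a *: avg_moment delta f))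
  - 4%:R^-1 * \sum_(y : bool) ln (\det (1%:M + a *: cond_moment delta y f)).

Definition J_tr (R : realType) (E : nat) (a : R) (w delta : 'I_E -> R)
    (f : encoder R) : R :=
  \sum_(e < E) w e * J a (delta e) f.

Definition J_star (R : realType) (a : R) : R :=
  ln (1 + a / 2%:R) - 2%:R^-1 * ln (1 + a).

Definition Gamma (R : realType) (a delta : R) : R :=
  2%:R^-1 * ln (1 + a ^+ 2 / (1 + a) * (delta * (1 - delta))).

Definition risk (R : realType) (delta : R) (h : input -> bool) : R :=
  Pr delta [pred xy | h xy.1 != xy.2].

Definition source_risk (R : realType) (E : nat) (w delta : 'I_E -> R)
    (h : input -> bool) : R :=
  \sum_(e < E) w e * risk (delta e) h.

Definition source_optimal (R : realType) (E : nat) (w delta : 'I_E -> R)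
    (g : classifier R) (f : encoder R) : Prop :=
  forall g' : classifier R,
    source_risk w delta (g \o f) <= source_risk w delta (g' \o f).

Definition is_max (R : realType) (T : Type) (F : T -> R) (m : R) : Prop :=
  (exists x, F x = m) /\ (forall x, F x <= m).

(* Main.v *)
(* Every conditional second moment M_y and their average M are symmetric 2x2
   matrices of trace 1, and det(I + aM) = 1 + a tr M + a^2 det M.  Hence
   det M <= 1/4 and det M_y >= 0 bound J by J_star, and f_C, which has det M = 1/4
   and det M_y = 0, attains the bound in every environment.  For f_S one still
   has det M = 1/4 but det M_y = delta (1 - delta), so its gap is exactly Gamma,
   which is O(delta): the gap is small when all source mismatches are small,
   whereas the target mismatch can be taken close to 1. *)
Require Import Defs.
From mathcomp Require Import all_boot all_order all_algebra.
From mathcomp Require Import reals exp ring lra.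

Import Order.TTheory GRing.Theory Num.Theory.

Local Open Scope ring_scope.

(** * Sums against the law of the input and label *)

(** The fibres of [(Xvar, Yvar)] partition the sample space. Values in a module let one statement
    serve both probabilities and matrix moments. *)
Lemma sum_law (R : realType) (V : lmodType R) (delta : R)
    (A : pred (input * bool)) (F : input * bool -> V) :
  \sum_(xy | A xy) law delta xy *: F xy =
  \sum_(o | A (Xvar o, Yvar o)) base_pmf delta o *: F (Xvar o, Yvar o).
Proof.
rewrite [RHS](partition_big (fun o => (Xvar o, Yvar o)) A) //=.
apply: eq_bigr => xy Axy; rewrite /law scaler_suml.
apply: eq_big => [o|o /eqP-> //].
by case: eqP => [->|]; rewrite ?Axy ?andbF.
Qed.

Lemma PrE (R : realType) (delta : R) (A : pred (input * bool)) :
  Pr delta A = \sum_(o | A (Xvar o, Yvar o)) base_pmf delta o.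
Proof.
have := @sum_law R R^o delta A (fun=> 1).
under eq_bigr do rewrite /GRing.scale /= mulr1.
by under [in RHS]eq_bigr do rewrite /GRing.scale /= mulr1.
Qed.

Lemma sum_bool2 (V : nmodType) (P : pred (bool * bool))
    (F : bool * bool -> V) :
  \sum_(o | P o) F o =
    (if P (true, true) then F (true, true) else 0)
  + (if P (true, false) then F (true, false) else 0)
  + ((if P (false, true) then F (false, true) else 0)
  + (if P (false, false) then F (false, false) else 0)).
Proof.
rewrite big_mkcond.
rewrite (eq_bigr (fun o => if P (o.1, o.2) then F (o.1, o.2) else 0)); last by case.
rewrite -(pair_bigA _ (fun i j => if P (i, j) then F (i, j) else 0)) /=.
by rewrite !big_bool.
Qed.

(** * Determinants of 2x2 matrices *)

Lemma det_mx2 (R : comPzRingType) (M : 'M[R]_2) :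
  \det M = M 0 0 * M 1 1 - M 0 1 * M 1 0.
Proof.
have l0 : lift 0 0 = 1 :> 'I_2 by exact/val_inj.
have l1 : lift 1 0 = 0 :> 'I_2 by exact/val_inj.
rewrite (expand_det_row _ 0) !big_ord_recl big_ord0 /cofactor !det_mx11 !mxE.
rewrite l0 l1 /= expr0 expr1 mul1r addr0 mulN1r mulrN.
by [].
Qed.

Lemma det_1DZ (R : comNzRingType) (a : R) (M : 'M[R]_2) :
  \det (1%:M + a *: M) = 1 + a * \tr M + a ^+ 2 * \det M.
Proof.
rewrite !det_mx2 !mxE /mxtrace !big_ord_recl big_ord0 /=.
have l0 : lift ord0 ord0 = 1 :> 'I_2 by exact/val_inj.
rewrite l0.
ring.
Qed.

(** AM-GM for the eigenvalues: the difference of the two sides is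
    [((M 0 0 - M 1 1) / 2) ^+ 2 + M 0 1 ^+ 2]. *)
Lemma det_sym_le (R : realFieldType) (M : 'M[R]_2) :
  M^T = M -> \det M <= (\tr M / 2%:R) ^+ 2.
Proof.
move=> sM; have M10 : M 1 0 = M 0 1 by rewrite -[in RHS]sM mxE.
have := sqr_ge0 (M 0 0 - M 1 1).
rewrite det_mx2 M10 /mxtrace !big_ord_recl big_ord0 /=.
have l0 : lift ord0 ord0 = 1 :> 'I_2 by exact/val_inj.
rewrite l0.
nra.
Qed.

(** * Second moments of an encoder *)

(** Conditioning on the label leaves only the mismatch bit random, and the label mass 1/2
    cancels. *)
Lemma cond_momentE (R : realType) (delta : R) (y : bool) (f : encoder R) :
  cond_moment delta y f =
    (1 - delta) *: (cvec (f (y, y)) *m (cvec (f (y, y)))^T)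
    + delta *: (cvec (f (y, ~~ y)) *m (cvec (f (y, ~~ y)))^T).
Proof.
rewrite /cond_moment sum_law PrE !sum_bool2 /base_pmf /bernoulli_pmf /Xvar /Yvar /=.
have h2 : 1 - 2%:R^-1 = 2%:R^-1 :> R by field.
by case: y => /=; rewrite ?(addr0, add0r) ?h2 -mulrDr addrC ?subrK ?subrKC
  mulr1 invrK scalerDr !scalerA !mulrA mulfV ?pnatr_eq0 // !mul1r // addrC.
Qed.

Lemma tr_outer_circle (R : realType) (z : circle R) :
  \tr (cvec z *m (cvec z)^T) = 1.
Proof.
rewrite -(cvecP z) /mxtrace; apply: eq_bigr => i _.
by rewrite !mxE big_ord1 mxE expr2.
Qed.

Lemma tr_cond_moment (R : realType) (delta : R) (y : bool) (f : encoder R) :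
  \tr (cond_moment delta y f) = 1.
Proof.
by rewrite cond_momentE mxtraceD !mxtraceZ !tr_outer_circle !mulr1 subrK.
Qed.

Lemma cond_moment_sym (R : realType) (delta : R) (y : bool) (f : encoder R) :
  (cond_moment delta y f)^T = cond_moment delta y f.
Proof. by rewrite cond_momentE !(linearD, linearZ) /= !trmx_mul !trmxK. Qed.

Lemma det_cond_moment_ge0 (R : realType) (delta : R) (y : bool) (f : encoder R) :
  0 <= delta <= 1 -> 0 <= \det (cond_moment delta y f).
Proof.
move=> /andP[d0 d1]; rewrite cond_momentE.
set u := cvec _; set v := cvec _.
(* The rank-one terms have zero determinant; the cross terms form the squared determinant of the
   matrix with columns [u] and [v]. *)
suff -> : \det ((1 - delta) *: (u *m u^T) + delta *: (v *m v^T)) =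
    (1 - delta) * delta * (u 0 0 * v 1 0 - u 1 0 * v 0 0) ^+ 2.
  by rewrite mulr_ge0 ?sqr_ge0 // mulr_ge0 // subr_ge0.
rewrite det_mx2 !mxE !big_ord1 !mxE; ring.
Qed.

Lemma tr_avg_moment (R : realType) (delta : R) (f : encoder R) :
  \tr (avg_moment delta f) = 1.
Proof. by rewrite mxtraceZ mxtraceD !tr_cond_moment; field. Qed.

Lemma avg_moment_sym (R : realType) (delta : R) (f : encoder R) :
  (avg_moment delta f)^T = avg_moment delta f.
Proof. by rewrite linearZ linearD /= !cond_moment_sym. Qed.

(* [ln] vanishes on nonpositive reals, so positivity of [x] is not required. *)
Lemma ler_ln_ge1 (R : realType) (x y : R) : 1 <= y -> x <= y -> ln x <= ln y.
Proof.
move=> y1 xy; case: (ltP 0 x) => x0; last by rewrite ln0 // ln_ge0.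
by rewrite ler_ln // posrE // (lt_le_trans ltr01).
Qed.

(** * The coding objective in one environment *)

(** This puts [J_star] in the shape of [J], with each determinant at its extremal value, so that the
    two can be compared term by term. *)
Lemma J_starE (R : realType) (a : R) : 0 < a ->
  J_star a = 2%:R^-1 * ln ((1 + a / 2%:R) ^+ 2)
             - 4%:R^-1 * \sum_(y : bool) ln (1 + a).
Proof.
move=> a0; rewrite lnXn ?big_bool /J_star ?ltr_wpDr ?divr_ge0 ?ltW //=; by field.
Qed.

Lemma J_le_star (R : realType) (a delta : R) (f : encoder R) :
  0 < a -> 0 <= delta <= 1 -> J a delta f <= J_star a.
Proof.
move=> a0 d01; rewrite J_starE // lerB //.
  rewrite ler_pM2l ?invr_gt0 ?ltr0n //; apply: ler_ln_ge1.
    by rewrite exprn_ege1 // lerDl divr_ge0 ?ltW.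
  rewrite det_1DZ tr_avg_moment; have := det_sym_le _ _ (avg_moment_sym _ delta f).
  rewrite tr_avg_moment => /(ler_wpM2l (sqr_ge0 a)); lra.
rewrite ler_pM2l ?invr_gt0 ?ltr0n //; apply: ler_sum => y _.
have dy := mulr_ge0 (sqr_ge0 a) (det_cond_moment_ge0 _ _ y f d01).
rewrite det_1DZ tr_cond_moment mulr1; apply: ler_ln_ge1; lra.
Qed.

Lemma J_f_C (R : realType) (a delta : R) :
  0 < a -> J a delta (@f_C R) = J_star a.
Proof.
move=> a0; rewrite J_starE // /J det_1DZ tr_avg_moment.
have -> : \det (avg_moment delta (@f_C R)) = 4%:R^-1.
  by rewrite det_mx2 /avg_moment !cond_momentE !mxE !big_ord1 !mxE /=; field.
have -> : 1 + a * 1 + a ^+ 2 * 4%:R^-1 = (1 + a / 2%:R) ^+ 2 by field.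
congr (_ - _ * _).
apply: eq_bigr => y _; rewrite det_1DZ tr_cond_moment.
have -> : \det (cond_moment delta y (@f_C R)) = 0.
  by case: y; rewrite det_mx2 cond_momentE !mxE !big_ord1 !mxE /=; ring.
by rewrite mulr1 mulr0 addr0.
Qed.

Lemma J_f_S (R : realType) (a delta : R) :
  0 < a -> 0 <= delta <= 1 -> J a delta (@f_S R) = J_star a - Gamma a delta.
Proof.
move=> a0 /andP[d0 d1]; rewrite J_starE // /J det_1DZ tr_avg_moment.
have -> : \det (avg_moment delta (@f_S R)) = 4%:R^-1.
  by rewrite det_mx2 /avg_moment !cond_momentE !mxE !big_ord1 !mxE /=; field.
have a1 : 0 < 1 + a by lra.
have dd : 0 < 1 + a ^+ 2 / (1 + a) * (delta * (1 - delta)).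
  by rewrite ltr_wpDr // mulr_ge0 ?(divr_ge0 (sqr_ge0 a) (ltW a1)) // mulr_ge0 ?subr_ge0.
(* Factoring out [1 + a] makes the logarithm split into the share of [J_star] and that of
   [Gamma]. *)
have detE y : \det (1%:M + a *: cond_moment delta y (@f_S R)) =
    (1 + a) * (1 + a ^+ 2 / (1 + a) * (delta * (1 - delta))).
  rewrite det_1DZ tr_cond_moment.
  have -> : \det (cond_moment delta y (@f_S R)) = delta * (1 - delta).
    by case: y; rewrite det_mx2 cond_momentE !mxE !big_ord1 !mxE /=; ring.
  by field; rewrite gt_eqF.
under eq_bigr do rewrite detE lnM ?posrE //.
rewrite !big_bool /=.
rewrite /Gamma (_ : 1 + a * 1 + _ = (1 + a / 2%:R) ^+ 2); last by field.
by field.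
Qed.

(** * Risks and supports *)

Lemma g_0_basis (R : realType) (c : bool) : @g_0 R (basis R c) = c.
Proof. by case: c; rewrite /g_0 !mxE /= ?ltr01 ?ltr10. Qed.

(** Only the values of [g] at the two basis vectors matter. Each value of the bit [S] has mass 1/2,
    and the label differs from it with conditional probability [delta]. *)
Lemma risk_f_S (R : realType) (delta : R) (g : classifier R) :
  risk delta (g \o @f_S R) =
    2%:R^-1 * ((if g (basis R true) then delta else 1 - delta)
               + (if g (basis R false) then 1 - delta else delta)).
Proof.
rewrite /risk PrE sum_bool2 /base_pmf /bernoulli_pmf /=.
by rewrite /f_S /=; case: (g _); case: (g _) => /=; field.
Qed.

Lemma risk_g_0_f_S (R : realType) (delta : R) :
  risk delta (@g_0 R \o @f_S R) = delta.
Proof. by rewrite risk_f_S !g_0_basis; field. Qed.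

Lemma risk_g_0_f_C (R : realType) (delta : R) :
  risk delta (@g_0 R \o @f_C R) = 0.
Proof. by rewrite /risk PrE sum_bool2 /= !g_0_basis /= !addr0. Qed.

(** At each value of [S], following the bit costs [delta] and opposing it costs [1 - delta], which
    is no smaller here. *)
Lemma risk_g_0_f_S_le (R : realType) (delta : R) (g : classifier R) :
  delta <= 2%:R^-1 -> risk delta (@g_0 R \o @f_S R) <= risk delta (g \o @f_S R).
Proof. by rewrite risk_g_0_f_S risk_f_S; do 2 case: (g _); lra. Qed.

Lemma input_supportT (R : realType) (delta : R) :
  0 < delta < 1 -> input_support delta = setT.
Proof.
move=> /andP[d0 d1]; have d1' : 0 < 1 - delta by rewrite subr_gt0.
have h2 : 0 < 2%:R^-1 :> R by rewrite invr_gt0 ltr0n.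
have h2' : 0 < 1 - 2%:R^-1 :> R by lra.
apply/setP => -[c s]; rewrite !inE PrE sum_bool2 /base_pmf /bernoulli_pmf /=.
by case: c s => [] [] /=; rewrite ?(addr0, add0r) mulr_gt0.
Qed.

Lemma Gamma_le (R : realType) (a delta : R) : 0 < a -> 0 <= delta <= 1 ->
  Gamma a delta <= a ^+ 2 / (2%:R * (1 + a)) * delta.
Proof.
move=> a0 /andP[d0 d1]; have a1 : 0 < 1 + a by lra.
have k0 : 0 <= a ^+ 2 / (1 + a) by rewrite divr_ge0 ?sqr_ge0 ?ltW.
rewrite (_ : _ * delta = 2%:R^-1 * (a ^+ 2 / (1 + a) * delta)); last first.
  by field; rewrite gt_eqF.
rewrite ler_pM2l ?invr_gt0 ?ltr0n //.
(* First [ln (1 + x) <= x], then [1 - delta <= 1]. *)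
apply: le_trans (le_ln1Dx _) _.
  by rewrite (lt_le_trans (ltrN10 _)) // mulr_ge0 // mulr_ge0 ?subr_ge0.
by rewrite ler_wpM2l // ler_piMr // gerBl.
Qed.

(** * Weighted averages over the source environments *)

Section SourceMixture.

Variables (R : realType) (E : nat) (w : 'I_E -> R).
Hypotheses (w_ge0 : forall e, 0 <= w e) (w_sum1 : \sum_(e < E) w e = 1).

Lemma weighted_sum_le (F : 'I_E -> R) (c : R) :
  (forall e, F e <= c) -> \sum_(e < E) w e * F e <= c.
Proof.
move=> Fc; rewrite -[leRHS]mul1r -w_sum1 mulr_suml.
by apply: ler_sum => e _; rewrite ler_wpM2l.
Qed.

Lemma J_tr_gap_f_S (a : R) (delta : 'I_E -> R) :
  0 < a -> (forall e, 0 <= delta e <= 1) ->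
  J_star a - J_tr a w delta (@f_S R) = \sum_(e < E) w e * Gamma a (delta e).
Proof.
move=> a0 d01; rewrite -[J_star a]mul1r -w_sum1 mulr_suml /J_tr -sumrB.
by apply: eq_bigr => e _; rewrite J_f_S // -mulrBr subKr.
Qed.

(** The single encoder [f_C] attains the bound in all environments at once, hence also in the
    average. *)
Lemma J_tr_max (a : R) (delta : 'I_E -> R) :
  0 < a -> (forall e, 0 <= delta e <= 1) -> is_max (J_tr a w delta) (J_star a).
Proof.
move=> a0 d01; split; last first.
  by move=> f; apply: weighted_sum_le => // e; apply: J_le_star.
exists (@f_C R); rewrite /J_tr; under eq_bigr do rewrite J_f_C //.
by rewrite -mulr_suml w_sum1 mul1r.
Qed.

Lemma sum_Gamma_le (a delta_max : R) (delta : 'I_E -> R) :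
  0 < a -> (forall e, 0 <= delta e <= 1) -> (forall e, delta e <= delta_max) ->
  \sum_(e < E) w e * Gamma a (delta e) <= a ^+ 2 / (2%:R * (1 + a)) * delta_max.
Proof.
move=> a0 d01 dm; apply: weighted_sum_le => e.
apply: le_trans (Gamma_le _ _ _ a0 (d01 e)) _.
by rewrite ler_wpM2l // divr_ge0 ?sqr_ge0 // mulr_ge0 // addr_ge0 // ltW.
Qed.

Lemma source_optimal_f_S (delta : 'I_E -> R) :
  (forall e, delta e <= 2%:R^-1) -> source_optimal w delta (@g_0 R) (@f_S R).
Proof.
move=> dh g; apply: ler_sum => e _.
by rewrite ler_wpM2l // risk_g_0_f_S_le.
Qed.

End SourceMixture.

Theorem theorem3p3 (R : realType) (a : R) (E : nat) (w : 'I_E -> R) (eta : R)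
    (a_gt0 : 0 < a) (E_gt0 : (0 < E)%N) (w_gt0 : forall e, 0 < w e)
    (w_sum1 : \sum_(e < E) w e = 1) (eta_gt0 : 0 < eta) :
  (exists (delta : 'I_E -> R) (delta_te : R),
      (forall e, 0 <= delta e <= 1) /\
      0 <= delta_te <= 1 /\
      injective delta /\
      (forall e, input_support (delta e) = input_support delta_te) /\
      (exists m : R, is_max (J_tr a w delta) m /\
                     0 <= m - J_tr a w delta (@f_S R) <= eta) /\
      1 - eta <= risk delta_te (@g_0 R \o @f_S R) /\
      source_optimal w delta (@g_0 R) (@f_S R) /\
      risk delta_te (@g_0 R \o @f_C R) = 0) /\
  (forall (delta : 'I_E -> R) (delta_max : R),
      (forall e, 0 < delta e <= delta_max) ->
      delta_max < 2%:R^-1 ->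
      J_star a - J_tr a w delta (@f_S R) = \sum_(e < E) w e * Gamma a (delta e) /\
      \sum_(e < E) w e * Gamma a (delta e)
        <= a ^+ 2 / (2%:R * (1 + a)) * delta_max /\
      risk (1 - delta_max) (@g_0 R \o @f_S R) = 1 - delta_max).
Proof.
have w_ge0 e : 0 <= w e by exact: ltW.
split; last first.
  move=> delta dm dP dm2.
  have d01 e : 0 <= delta e <= 1 by have /andP[? ?] := dP e; lra.
  split; first exact: J_tr_gap_f_S.
  split; last exact: risk_g_0_f_S.
  by apply: sum_Gamma_le => // e; have /andP[] := dP e.
pose K := a ^+ 2 / (2%:R * (1 + a)).
have K0 : 0 < K by rewrite divr_gt0 ?exprn_gt0 // mulr_gt0 ?ltr0n // addr_gt0.
(* The bound 1/4 keeps [dm] below 1/2, [eta] gives the target error, and [eta / K] makes the gap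
   bound [K * dm] at most [eta]. *)
pose dm := Num.min 4%:R^-1 (Num.min eta (eta / K)).
have dm0 : 0 < dm by rewrite !lt_min invr_gt0 ltr0n eta_gt0 divr_gt0.
(* Unfolding only the right-hand [dm] yields the three bounds. *)
have : dm <= dm by [].
rewrite {2}/dm !le_min => /and3P[dm4 dm_eta dm_K].
rewrite ler_pdivlMr // mulrC in dm_K.
have E0 : 0 < E%:R :> R by rewrite ltr0n.
(* Equally spaced, hence distinct; the successor keeps the first value positive, and the last one
   equals [dm]. *)
pose delta (e : 'I_E) := dm * (e.+1%:R / E%:R).
have delta_gt0 e : 0 < delta e by rewrite mulr_gt0 ?divr_gt0 ?ltr0n.
have delta_le e : delta e <= dm.
  by rewrite ler_piMr ?(ltW dm0) // ler_pdivrMr // mul1r ler_nat.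
have d01 e : 0 <= delta e <= 1 by have := delta_gt0 e; have := delta_le e; lra.
exists delta, (1 - dm); split; first exact: d01.
split; first by lra.
split.
  move=> i j /(mulfI (lt0r_neq0 dm0)) /(mulIf (invr_neq0 (lt0r_neq0 E0))) /eqP.
  by rewrite eqr_nat eqSS => /eqP/val_inj.
split.
  (* All mismatches, [1 - dm] included, lie strictly between 0 and 1, so every support is full. *)
  move=> e; rewrite !input_supportT //; first by lra.
  by have := delta_gt0 e; have := delta_le e; lra.
split.
  exists (J_star a); have maxJ := J_tr_max _ _ _ w_ge0 w_sum1 _ _ a_gt0 d01.
  split=> //; rewrite subr_ge0 maxJ.2 /= J_tr_gap_f_S //.
  exact: le_trans (sum_Gamma_le _ _ _ w_ge0 w_sum1 _ _ _ a_gt0 d01 delta_le) dm_K.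
split; first by rewrite risk_g_0_f_S lerB.
split; last exact: risk_g_0_f_C.
by apply: source_optimal_f_S => // e; have := delta_le e; lra.
Qed.
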